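(* Let $x,y$ be Hermitian $n\times n$ complex matrices, let $t_0>0$, and let $u(t)=e^{itx}e^{iy}$. Suppose that for all $t\in[0,t_0]$ we have $\|u(t)-1\|<\sqrt{2}$ and that $u(t)$ has distinct eigenvalues $e^{i\theta_k(t)}$, $k=1,\dots,n$, where $\theta_1(t)>\theta_2(t)>\dots>\theta_n(t)$ are the eigenvalues of $-i\log(u(t))$ (these are smooth functions of $t$). Let $v_k(t)$ be a unit eigenvector of $u(t)$ for the eigenvalue $e^{i\theta_k(t)}$. If for some $s\in[0,t_0]$ we have $$\sum_{k=1}^m\theta_k''(s)=0\qquad\text{for all }1\le m\le n-1,$$ then for each such $m$ the span of $\{v_1(s),\dots,v_m(s)\}$ is invariant for both $x$ and $y$, and $[x,y]=0$.
   Context: $\|\cdot\|$ denotes the spectral (operator) norm on $M_n(\mathbb C)$. For a unitary matrix $u$ with $\|u-1\|<2$, $\log(u)$ is the principal branch of the logarithm, so $-i\log(u)$ is the unique Hermitian matrix $z$ with $e^{iz}=u$ and $\|z\|<\pi$. $[x,y]=xy-yx$. *)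

(* Defs.v *)
From HB Require Import structures.
From mathcomp Require Import all_boot all_order all_algebra.
From mathcomp Require Import all_classical all_reals all_analysis.
From mathcomp Require Export sesquilinear complex.

Set Implicit Arguments.
Unset Strict Implicit.
Unset Printing Implicit Defensive.

Import Order.TTheory GRing.Theory Num.Theory.
Import numFieldNormedType.Exports.

Local Open Scope classical_set_scope.
Local Open Scope ring_scope.

(* The limit is taken in the product (entrywise) topology of 'M[C]_n. *)
Definition expmx (C : numFieldType) (n : nat) (A : 'M[C]_n) : 'M[C]_n :=
  lim (series (fun k : nat => (k`!%:R)^-1 *: A ^+ k) @ \oo).

Definition l2norm (R : realType) (n : nat) (v : 'cV[R[i]]_n) : R :=
  Num.sqrt (\sum_(i < n) Normc.normc (v i ord0) ^+ 2).

(* The library's norm on matrices is the entrywise maximum, not this one. *)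
Definition opnorm (R : realType) (n : nat) (A : 'M[R[i]]_n) : R :=
  sup [set l2norm (A *m v) | v in [set v : 'cV[R[i]]_n | l2norm v <= 1]].

(* i z for the unique Hermitian z with e^{iz} = u and ||z|| < pi; such a z
   exists and is unique when u is unitary and ||u - 1|| < 2. *)
Definition logmx (R : realType) (n : nat) (u : 'M[R[i]]_n) : 'M[R[i]]_n :=
  'i%C *: xget 0 [set z : 'M[R[i]]_n |
    [/\ z \is hermsymmx, expmx ('i%C *: z) = u & opnorm z < pi]].

Definition expi (R : realType) (a : R) : R[i] := (cos a +i* sin a)%C.

(* Derivative relative to D: one-sided at the endpoints of an interval D, and
   dependent only on the values of f on D when x \in D. *)
Definition derive1_within (R : realType) (D : set R) (f : R -> R) (x : R) : R :=
  lim ((fun y => (y - x)^-1 * (f y - f x)) @ within D x^').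

(* Main.v *)
(* Write lam_k = exp(i theta_k), P_k for the eigenprojection of u for lam_k, and
   a prime for values at a nearby time t'. Everything follows from
     P_j (u' - u) P'_k = (lam'_k - lam_j) P_j P'_k.
   As sum_k tr(P_j P'_k) = 1, every lam_j has some lam'_k nearby, and the ordering
   of the angles forces k = j, so each lam_k is continuous. Dividing by t' - t, and
   since u has derivative i x u, one gets the derivatives of lam_k and P_k, whence
     theta_k'  = tr(P_k x),
     theta_k'' = sum_(j <> k) cot((theta_k - theta_j) / 2) tr(P_j x P_k x).
   The summand is antisymmetric in (j, k), and positive multiples of
   tr(P_j x P_k x) >= 0 remain when k <= m < j, because all angles lie in
   (-pi/2, pi/2). The vanishing of the partial sums thus makes x diagonal in the
   eigenbasis of u(s). Then x commutes with u(s), hence with exp(iy) = u(0), which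
   has simple spectrum and also commutes with y; so x and y are both diagonal in
   the eigenbasis of u(0). *)

Require Import Defs.
From mathcomp Require Import all_boot all_order all_algebra.
From mathcomp Require Import all_classical all_reals all_analysis.
From mathcomp Require Import spectral ring lra.
Import Order.TTheory GRing.Theory Num.Theory.
Import numFieldNormedType.Exports.
Local Open Scope classical_set_scope.
Local Open Scope ring_scope.
Local Open Scope sesquilinear_scope.
Set Implicit Arguments.
Unset Strict Implicit.
Unset Printing Implicit Defensive.

(** * Limits of matrices and of complex numbers *)

Section MatrixLimits.
Context {K : numFieldType} {T : Type} {F : set_system T} {FF : Filter F}.

Lemma cvg_mxP m n (f : T -> 'M[K]_(m, n)) (A : 'M[K]_(m, n)) :
  f t @[t --> F] --> A <-> forall i j, f t i j @[t --> F] --> A i j.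
Proof.
split=> [fA i j|fA].
  exact: (@continuous_cvg _ _ _ F FF f (fun M : 'M[K]_(m, n) => M i j) A
    (@coord_continuous K m n i j A) fA).
apply/cvg_ballP => e e0.
have : \forall t \near F, forall ij : 'I_m * 'I_n,
    ball (A ij.1 ij.2) e (f t ij.1 ij.2).
  apply: filter_forall => ij.
  by move/cvg_ballP : (fA ij.1 ij.2); apply.
apply: filterS => t ft; split => // i j; exact: (ft (i, j)).
Qed.

Lemma cvg_bigsum {V : normedModType K} (I : Type) (r : seq I) (p : pred I)
    (f : I -> T -> V) (a : I -> V) :
  (forall i, p i -> f i t @[t --> F] --> a i) ->
  \sum_(i <- r | p i) f i t @[t --> F] --> \sum_(i <- r | p i) a i.
Proof. by move=> fa; apply: cvg_big => //; exact: add_continuous. Qed.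

Lemma cvg_mulmx m n p (f : T -> 'M[K]_(m, n)) (g : T -> 'M[K]_(n, p))
    (A : 'M[K]_(m, n)) (B : 'M[K]_(n, p)) :
  f t @[t --> F] --> A -> g t @[t --> F] --> B ->
  f t *m g t @[t --> F] --> A *m B.
Proof.
move=> /cvg_mxP fA /cvg_mxP gB; apply/cvg_mxP => i j.
under eq_fun do rewrite mxE.
rewrite mxE; apply: (@cvg_bigsum K^o) => k _.
by apply: cvgM; [exact: fA|exact: gB].
Qed.

Lemma cvg_mulmx_r0 m n p (A : 'M[K]_(m, n)) (g : T -> 'M[K]_(n, p)) :
  g t @[t --> F] --> (0 : 'M[K]_(n, p)) ->
  A *m g t @[t --> F] --> (0 : 'M[K]_(m, p)).
Proof.
by move=> g0; rewrite -(mulmx0 p A); apply: cvg_mulmx => //; exact: cvg_cst.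
Qed.

Lemma cvg_mxtrace n (f : T -> 'M[K]_n) (A : 'M[K]_n) :
  f t @[t --> F] --> A -> \tr (f t) @[t --> F] --> \tr A.
Proof.
by move=> /cvg_mxP fA; apply: (@cvg_bigsum K^o) => k _; exact: fA.
Qed.

Lemma cvg0_le_norm (V : normedModType K) (f : T -> V) (g : T -> K^o) :
  (\forall t \near F, `|f t| <= g t) ->
  g t @[t --> F] --> (0 : K^o) -> f t @[t --> F] --> (0 : V).
Proof.
move=> fg /cvgr0Pnorm_lt g0; apply/cvgr0Pnorm_lt => e e0.
apply: filterS2 fg (g0 e e0) => t fgt; apply: le_lt_trans.
by rewrite ger0_norm// (le_trans _ fgt).
Qed.

(** Serves for products whose second factor is an eigenprojection at a nearby time: its entries are
    bounded by 1 before its continuity is known. *)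
Lemma cvg0_mulmx_bounded m n p (f : T -> 'M[K]_(m, n))
    (g : T -> 'M[K]_(n, p)) :
  f t @[t --> F] --> (0 : 'M[K]_(m, n)) ->
  (\forall t \near F, forall i j, `|g t i j| <= 1) ->
  f t *m g t @[t --> F] --> (0 : 'M[K]_(m, p)).
Proof.
move=> /cvg_mxP f0 g1; apply/cvg_mxP => i j; rewrite mxE.
apply: (@cvg0_le_norm _ _ (fun t => \sum_k `|f t i k|)).
  apply: filterS g1 => t gt; rewrite mxE (le_trans (ler_norm_sum _ _ _))//.
  by apply: ler_sum => k _; rewrite normrM ler_piMr.
rewrite [X in _ --> X](_ : _ = \sum_(k < n) `|(0 : K^o)|); last first.
  by rewrite big1// => k _; rewrite normr0.
apply: (@cvg_bigsum K^o) => k _; apply: cvg_norm.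
by move: (f0 i k); rewrite mxE.
Qed.

End MatrixLimits.

Section ComplexLimits.
Context {R : realType} {T : Type} {F : set_system T} {FF : Filter F}.
Local Notation C := (R[i] : numFieldType).

Lemma real_complex_norm (a : R) : `|a%:C%C : C| = (`|a|)%:C%C.
Proof. by rewrite normc_def /= expr0n addr0 sqrtr_sqr. Qed.

Lemma cvg_real_complex (f : T -> R) (l : R) :
  f t @[t --> F] --> l -> (f t)%:C%C @[t --> F] --> (l%:C%C : C).
Proof.
move=> fl; have {}fl := (@cvgrPdist_lt R R^o T F FF _ _).1 fl.
apply/(@cvgrPdist_lt C C^o T F FF) => e e0.
have re : e = (complex.Re e)%:C%C.
  by move: e0; rewrite ltcE /= => /andP[/eqP]; case: (e) => a b /= ->.
have e0' : 0 < complex.Re e by move: e0; rewrite ltcE => /andP[].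
apply: filterS (fl _ e0') => t ft.
by rewrite -rmorphB /= real_complex_norm re ltcR.
Qed.

Lemma cvg_Re_Im (f : T -> C) (l : C) :
  f t @[t --> F] --> l ->
  complex.Re (f t) @[t --> F] --> complex.Re l /\
  complex.Im (f t) @[t --> F] --> complex.Im l.
Proof.
move=> fl; have {}fl := (@cvgrPdist_lt C C^o T F FF _ _).1 fl.
split; apply/(@cvgrPdist_lt R R^o T F FF) => e e0;
  have ee : (0 : C) < e%:C%C by rewrite (ltcR 0 e).
  apply: filterS (fl _ ee) => t ft.
  rewrite -ltcR (le_lt_trans _ ft)// (le_trans _ (normc_ge_Re _))//.
  by rewrite raddfB.
apply: filterS (fl _ ee) => t ft.
rewrite -ltcR (le_lt_trans _ ft)//.
have := normc_ge_Re ((l - f t) * 'i%C); rewrite ReiNIm normrN normrM.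
rewrite [`|'i%C|](_ : _ = 1) ?mulr1; last first.
  by rewrite normc_def /= expr0n expr1n add0r sqrtr1.
by rewrite raddfB.
Qed.

Lemma cvg_complex (f g : T -> R) (a b : R) :
  f t @[t --> F] --> a -> g t @[t --> F] --> b ->
  (f t +i* g t)%C @[t --> F] --> ((a +i* b)%C : C).
Proof.
move=> fa gb.
have -> : (fun t => (f t +i* g t)%C) =
    (fun t => (f t)%:C%C + 'i%C * (g t)%:C%C : C).
  by apply/funext => t; exact: complexE.
have -> : (a +i* b)%C = a%:C%C + 'i%C * b%:C%C by exact: complexE.
apply: (@cvgD C C^o); first exact: cvg_real_complex.
by apply: (@cvgMr C) ; exact: cvg_real_complex.
Qed.

End ComplexLimits.

(** * The unitary group generated by a Hermitian matrix *)

Section Slopes.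
Context {R : realType}.

Lemma is_derive_slope (f : R -> R) (a df : R) : is_derive a 1 f df ->
  (t - a)^-1 * (f t - f a) @[t --> a^'] --> df.
Proof.
move=> [fd fdf].
have fcvg : h^-1 *: ((f \o shift a) (h *: (1 : R^o)) - f a) @[h --> 0^'] --> df.
  by rewrite -fdf; exact: fd.
have ta : (t - a) @[t --> a^'] --> (0 : R)^'.
  move=> A /nbhs_ballP[e /= e0 eA]; apply/nbhs_ballP; exists e => //= t.
  rewrite /ball /= => ate ta; apply: eA => /=; last first.
    by rewrite subr_eq0.
  by rewrite /ball /= sub0r normrN distrC.
have := cvg_comp _ _ ta fcvg; apply: cvg_trans; apply: near_eq_cvg.
by near=> t; rewrite /= /GRing.scale/= mulr1 subrK.
Unshelve. all: by end_near. Qed.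

End Slopes.

(** * The exponential on the unit circle *)

Section UnitCircle.
Context {R : realType}.
Implicit Types a b : R.

Lemma expiD a b : expi (a + b) = expi a * expi b.
Proof.
rewrite /expi cosD sinD; apply/eqP; rewrite eq_complex /=.
by rewrite eqxx/= addrC.
Qed.

Lemma conj_expi a : Num.conj (expi a) = expi (- a).
Proof. by rewrite /expi cosN sinN. Qed.

Lemma expi_conj a : expi a * Num.conj (expi a) = 1.
Proof.
by rewrite conj_expi -expiD subrr /expi cos0 sin0.
Qed.

(** Powers of ['i] are real at even and imaginary at odd exponents, so the real and imaginary parts
    of the terms are exactly the coefficients of the cosine and sine series. *)
Lemma series_expi a :
  series (fun k : nat => (k`!%:R)^-1 * ('i%C * a%:C%C) ^+ k : (R[i] : numFieldType)) @ \oo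
    --> (expi a : (R[i] : numFieldType)).
Proof.
have termE (k : nat) : (k`!%:R)^-1 * ('i%C * a%:C%C) ^+ k =
    (cos_coeff a k +i* sin_coeff a k)%C :> R[i].
  have -> : (k`!%:R)^-1 = ((k`!%:R)^-1)%:C%C :> R[i].
    by rewrite fmorphV rmorph_nat.
  rewrite exprMn -rmorphXn /= mulrCA -rmorphM /= /cos_coeff /sin_coeff /=.
  have -> : 'i%C ^+ k = (((~~ odd k)%:R * (-1) ^+ k./2)
      +i* ((odd k)%:R * (-1) ^+ k.-1./2))%C :> R[i].
    rewrite -[in LHS](odd_double_half k) exprD -mul2n exprM sqr_i.
    have -> : (-1) ^+ k./2 = ((-1) ^+ k./2)%:C%C :> R[i].
      by rewrite rmorphXn /= rmorphN1.
    have [ok|ok] /= := boolP (odd k).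
      (* The library's sine coefficient halves [k.-1]; for odd [k] this agrees with halving [k]. *)
      have -> : k.-1./2 = k./2.
        by case: k ok => // k; rewrite /= uphalf_half => /negbTE ->.
      by rewrite expr1; simpc; rewrite ?(mul0r, mul1r, mulr0, mulr1).
    by rewrite expr0; simpc; rewrite ?(mul0r, mul1r, mulr0, mulr1).
  simpc; move: (_%:R^-1) (_ * _ ^+ _) (_ * _ ^+ _) (a ^+ k) => p q r z.
  by congr (_ +i* _)%C; ring.
have -> : series (fun k : nat =>
      (k`!%:R)^-1 * ('i%C * a%:C%C) ^+ k : (R[i] : numFieldType)) =
    (fun n => (series (cos_coeff a) n +i* series (sin_coeff a) n)%C).
  apply/funext => n; rewrite /series /=.
  elim: n => [|n IH]; first by rewrite !big_geq.
  by rewrite !big_nat_recr//= IH termE.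
rewrite /expi cos.unlock sin.unlock; apply: cvg_complex.
- exact: is_cvg_series_cos_coeff.
- exact: is_cvg_series_sin_coeff.
Qed.

Lemma expi_slope (d t : R) :
  (h - t)^-1%:C%C * (expi (h * d) - expi (t * d)) @[h --> t^'] -->
  ('i%C * d%:C%C * expi (t * d) : (R[i] : numFieldType)).
Proof.
have dM : is_derive t 1 (fun h : R => h * d) d.
  by apply: is_derive_eq; rewrite scaler0 add0r /GRing.scale /= mulr1.
have dcos : is_derive t 1 (fun h : R => cos (h * d)) (- (d * sin (t * d))).
  have := is_derive1_comp (g := fun h : R => h * d) (is_derive_cos (t * d)) dM.
  by rewrite mulNr [sin _ * d]mulrC.
have dsin : is_derive t 1 (fun h : R => sin (h * d)) (d * cos (t * d)).
  have := is_derive1_comp (g := fun h : R => h * d) (is_derive_sin (t * d)) dM.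
  by rewrite [cos _ * d]mulrC.
have -> : 'i%C * d%:C%C * expi (t * d) =
    ((- (d * sin (t * d))) +i* (d * cos (t * d)))%C :> R[i].
  by rewrite /expi; simpc.
have -> : (fun h => (h - t)^-1%:C%C * (expi (h * d) - expi (t * d)) :
    (R[i] : numFieldType)) =
  (fun h => ((h - t)^-1 * (cos (h * d) - cos (t * d))
         +i* ((h - t)^-1 * (sin (h * d) - sin (t * d))))%C).
  by apply/funext => h; rewrite /expi; simpc.
by apply: cvg_complex; exact: is_derive_slope.
Qed.

End UnitCircle.

(** * Exponentials of diagonalized matrices *)

Section DiagonalizedExponential.
Context {K : numFieldType} {n : nat}.

Lemma exprmx_diag_similar (V W : 'M[K]_n) (z : 'rV[K]_n) (k : nat) :
  W *m V = 1%:M ->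
  (V *m diag_mx z *m W) ^+ k = V *m diag_mx (\row_j z 0 j ^+ k) *m W.
Proof.
move=> WV; elim: k => [|k IH].
  have -> : \row_j z 0 j ^+ 0 = const_mx 1 by apply/rowP => j; rewrite !mxE expr0.
  by rewrite diag_const_mx mulmx1 (mulmx1C WV).
rewrite exprS IH.
change ((V *m diag_mx z *m W) *m (V *m diag_mx (\row_j z 0 j ^+ k) *m W) =
  V *m diag_mx (\row_j z 0 j ^+ k.+1) *m W).
rewrite !mulmxA -[V *m diag_mx z *m W *m V]mulmxA WV mulmx1.
rewrite -[V *m diag_mx z *m diag_mx _]mulmxA mulmx_diag.
by congr (_ *m diag_mx _ *m _); apply/rowP => j; rewrite !mxE exprS.
Qed.

Lemma eq_diag_similar (V W : 'M[K]_n) (z z' : 'rV[K]_n) :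
  (forall j, z 0 j = z' 0 j) -> V *m diag_mx z *m W = V *m diag_mx z' *m W.
Proof. by move=> zz'; congr (_ *m diag_mx _ *m _); apply/rowP. Qed.

Lemma scale_diag_similar (V W : 'M[K]_n) (a : K) (z : 'rV[K]_n) :
  a *: (V *m diag_mx z *m W) = V *m diag_mx (\row_j (a * z 0 j)) *m W.
Proof.
rewrite scalemxAl scalemxAr -linearZ /=; congr (_ *m diag_mx _ *m _).
by apply/rowP => j; rewrite !mxE.
Qed.

(** Conjugation passes through powers and finite sums, so each partial sum is the conjugate of a
    diagonal matrix of scalar partial sums. *)
Lemma expmx_diag_similar (V W : 'M[K]_n) (z e : 'rV[K]_n) :
  W *m V = 1%:M ->
  (forall j, series (fun k : nat => (k`!%:R)^-1 * z 0 j ^+ k) @ \oo --> e 0 j) ->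
  series (fun k : nat => (k`!%:R)^-1 *: (V *m diag_mx z *m W) ^+ k) @ \oo -->
    V *m diag_mx e *m W.
Proof.
move=> WV ze.
have -> : series (fun k : nat => (k`!%:R)^-1 *: (V *m diag_mx z *m W) ^+ k) =
    (fun N => V *m
      diag_mx (\row_j series (fun k : nat => (k`!%:R)^-1 * z 0 j ^+ k) N) *m W).
  apply/funext => N; rewrite /series /=.
  under eq_bigr do rewrite exprmx_diag_similar// scalemxAl scalemxAr.
  rewrite -mulmx_suml -mulmx_sumr; congr (_ *m _ *m _).
  under eq_bigr do rewrite -linearZ.
  rewrite -linear_sum /=; congr diag_mx; apply/rowP => j.
  by rewrite summxE !mxE; apply: eq_bigr => k _; rewrite !mxE.
apply: cvg_mulmx; last exact: cvg_cst.
apply: cvg_mulmx; first exact: cvg_cst.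
apply/cvg_mxP => i j; rewrite !mxE.
under eq_fun do rewrite !mxE.
case: (i == j); last by rewrite mulr0n; under eq_fun do rewrite mulr0n; exact: cvg_cst.
by rewrite mulr1n; under eq_fun do rewrite mulr1n; exact: ze.
Qed.

End DiagonalizedExponential.

Section UnitaryGroup.
Context {R : realType} {n : nat}.
Local Notation C := (R[i] : numFieldType).
Variable x : 'M[R[i]]_n.
Hypothesis hx : x \is hermsymmx.

Lemma hermsymmx_tC : x^t* = x.
Proof. by have /is_hermitianmxP := hx; rewrite expr0 scale1r. Qed.

Lemma hermsymmx_diag : exists (U : 'M[R[i]]_n) (d : 'I_n -> R),
  U \is unitarymx /\ x = U^t* *m diag_mx (\row_j (d j)%:C%C) *m U.
Proof.
have Uu := spectral_unitarymx x.
have /mxOverP dR := hermitian_spectral_diag_real hx.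
have /orthomx_spectralP xE := hermitian_normalmx hx.
rewrite invmx_unitary// in xE.
exists (spectralmx x), (fun j => complex.Re (spectral_diag x 0 j)); split=> //.
rewrite {1}xE; apply: eq_diag_similar => j.
by rewrite !mxE RRe_real.
Qed.

(** One diagonalization serves all [t] at once. Convergence is stated rather than the value of
    [expmx], since both the existence of the limit and its formula are drawn from it. *)
Lemma expmx_spectral : exists (U : 'M[R[i]]_n) (d : 'I_n -> R),
  [/\ U \is unitarymx, x = U^t* *m diag_mx (\row_j (d j)%:C%C) *m U &
  forall t : R,
  (series (fun k : nat => (k`!%:R)^-1 *: (('i%C * t%:C%C) *: x : 'M[C]_n) ^+ k) @ \oo -->
    (U^t* *m diag_mx (\row_j expi (t * d j)) *m U : 'M[C]_n))].
Proof.
have [U [d [Uu xE]]] := hermsymmx_diag.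
exists U, d; split=> // t.
have -> : ('i%C * t%:C%C) *: x =
    U^t* *m diag_mx (\row_j ('i%C * (t * d j)%:C%C)) *m U.
  rewrite [in LHS]xE; apply: etrans (scale_diag_similar _ _ _ _) _.
  by apply: eq_diag_similar => j; rewrite !mxE rmorphM /= mulrA.
apply: expmx_diag_similar; first exact/unitarymxP.
by move=> j; rewrite !mxE; exact: series_expi.
Qed.

Lemma cvg_expmx (t : R) :
  series (fun k : nat => (k`!%:R)^-1 *: (('i%C * t%:C%C) *: x : 'M[C]_n) ^+ k) @ \oo -->
    expmx (('i%C * t%:C%C) *: x : 'M[C]_n).
Proof.
have [U [d [_ _ Ucvg]]] := expmx_spectral; exact: cvgP (Ucvg t).
Qed.

Lemma expmx_hermE : exists (U : 'M[R[i]]_n) (d : 'I_n -> R),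
  [/\ U \is unitarymx, x = U^t* *m diag_mx (\row_j (d j)%:C%C) *m U &
  forall t : R, expmx (('i%C * t%:C%C) *: x) =
    U^t* *m diag_mx (\row_j expi (t * d j)) *m U].
Proof.
have [U [d [Uu xE Ucvg]]] := expmx_spectral; exists U, d; split=> // t.
apply: (@cvg_lim 'M[C]_n _ _ _ _ _ _ (Ucvg t)).
exact: (@norm_hausdorff C 'M[C]_n).
Qed.

Lemma expmx_herm_unitary (t : R) : expmx (('i%C * t%:C%C) *: x) \is unitarymx.
Proof.
have [U [d [Uu _ ->]]] := expmx_hermE.
apply: mul_unitarymx; last exact: Uu.
apply: mul_unitarymx; first by rewrite trmxC_unitary.
apply/unitarymxP.
rewrite tr_diag_mx map_diag_mx mulmx_diag -diag_const_mx; congr diag_mx.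
by apply/rowP => j; rewrite !mxE expi_conj.
Qed.

Lemma expmx_herm0 : expmx (('i%C * (0 : R)%:C%C) *: x) = 1%:M.
Proof.
have [U [d [Uu _ ->]]] := expmx_hermE.
have -> : \row_j expi (0 * d j) = const_mx 1 :> 'rV[R[i]]_n.
  by apply/rowP => j; rewrite !mxE mul0r /expi cos0 sin0.
by rewrite diag_const_mx mulmx1; apply/mulmx1C/unitarymxP.
Qed.

(** [A] commutes with every partial sum of the series, and limits are unique. *)
Lemma expmx_herm_comm (A : 'M[R[i]]_n) (t : R) : A *m x = x *m A ->
  A *m expmx (('i%C * t%:C%C) *: x) = expmx (('i%C * t%:C%C) *: x) *m A.
Proof.
move=> Ax; set S := series (fun k : nat =>
  (k`!%:R)^-1 *: (('i%C * t%:C%C) *: x : 'M[C]_n) ^+ k).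
have AS N : A *m S N = S N *m A.
  rewrite /S /series /= mulmx_suml mulmx_sumr; apply: eq_bigr => k _.
  rewrite -scalemxAl -scalemxAr; congr (_ *: _).
  elim: k => [|k IH]; first by
    rewrite expr0; exact: (etrans (mulmx1 _) (esym (mul1mx _))).
  rewrite exprS; set y := _ *: x in IH *.
  change (A *m (y *m y ^+ k) = y *m y ^+ k *m A).
  by rewrite mulmxA /y -scalemxAr Ax scalemxAl -!mulmxA IH.
have l1 : A *m S N @[N --> \oo] --> (A *m expmx (('i%C * t%:C%C) *: x) : 'M[C]_n).
  by apply: cvg_mulmx; [exact: cvg_cst|exact: cvg_expmx].
have l2 : A *m S N @[N --> \oo] --> (expmx (('i%C * t%:C%C) *: x) *m A : 'M[C]_n).
  under eq_fun do rewrite AS.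
  by apply: cvg_mulmx; [exact: cvg_expmx|exact: cvg_cst].
exact: (@cvg_unique _ (@norm_hausdorff C 'M[C]_n) _ _ _ _ l1 l2).
Qed.

Lemma expmx_herm_slope (t : R) :
  (h - t)^-1%:C%C *: (expmx (('i%C * h%:C%C) *: x) - expmx (('i%C * t%:C%C) *: x))
   @[h --> t^'] --> (('i%C *: x) *m expmx (('i%C * t%:C%C) *: x) : 'M[C]_n).
Proof.
have [U [d [Uu xE eE]]] := expmx_hermE.
have -> : ('i%C *: x) *m expmx (('i%C * t%:C%C) *: x) =
    U^t* *m diag_mx (\row_j ('i%C * (d j)%:C%C * expi (t * d j))) *m U.
  rewrite eE {1}xE -scalemxAl -!mulmxA [U *m (_ *m _)]mulmxA (unitarymxP _)// mul1mx.
  rewrite scalemxAr; congr (_ *m _); rewrite scalemxAl !mulmxA; congr (_ *m _).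
  rewrite -linearZ /= mulmx_diag; congr diag_mx; apply/rowP => j.
  by rewrite !mxE.
have -> : (fun h : R => (h - t)^-1%:C%C *:
     (expmx (('i%C * h%:C%C) *: x) - expmx (('i%C * t%:C%C) *: x)) : 'M[C]_n) =
   (fun h => U^t* *m
     diag_mx (\row_j ((h - t)^-1%:C%C * (expi (h * d j) - expi (t * d j)))) *m U).
  apply/funext => h; rewrite !eE -mulmxBl -mulmxBr -linearB /=.
  rewrite (scale_diag_similar _ _ (h - t)^-1%:C%C).
  by apply: eq_diag_similar => j; rewrite !mxE.
apply: cvg_mulmx; last exact: cvg_cst.
apply: cvg_mulmx; first exact: cvg_cst.
apply/cvg_mxP => i j; rewrite !mxE.
under eq_fun do rewrite !mxE.
case: (i == j); last by rewrite mulr0n; under eq_fun do rewrite mulr0n; exact: cvg_cst.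
by rewrite mulr1n; under eq_fun do rewrite mulr1n; exact: expi_slope.
Qed.

End UnitaryGroup.

(** * Spectral resolutions *)

Section HilbertSchmidt.
Context {C : numClosedFieldType}.

(** This is the squared Hilbert-Schmidt norm; its positivity bounds overlaps and couplings from
    below, and its definiteness turns a vanishing trace into a vanishing matrix. *)
Lemma mxtrace_mul_tC m n (B : 'M[C]_(m, n)) :
  \tr (B *m B^t*) = \sum_i \sum_j `|B i j| ^+ 2.
Proof.
apply: eq_bigr => i _; rewrite mxE; apply: eq_bigr => j _.
by rewrite !mxE normCK.
Qed.

Lemma mxtrace_mul_tC_ge0 m n (B : 'M[C]_(m, n)) : 0 <= \tr (B *m B^t*).
Proof.
rewrite mxtrace_mul_tC; apply: sumr_ge0 => i _; apply: sumr_ge0 => j _.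
by rewrite exprn_ge0.
Qed.

Lemma mxtrace_mul_tC_eq0 m n (B : 'M[C]_(m, n)) : \tr (B *m B^t*) = 0 -> B = 0.
Proof.
rewrite mxtrace_mul_tC => /eqP; rewrite psumr_eq0; last first.
  by move=> i _; apply: sumr_ge0 => j _; rewrite exprn_ge0.
move=> /allP B0; apply/matrixP => i j; rewrite mxE.
have := B0 i (mem_index_enum i); rewrite /= psumr_eq0; last first.
  by move=> k _; rewrite exprn_ge0.
by move=> /allP/(_ j (mem_index_enum j)); rewrite /= sqrf_eq0 normr_eq0 => /eqP.
Qed.

Lemma tC_mulmx m n p (A : 'M[C]_(m, n)) (B : 'M[C]_(n, p)) :
  (A *m B)^t* = B^t* *m A^t*.
Proof. by rewrite trmx_mul map_mxM. Qed.

End HilbertSchmidt.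

(** Over [d] steps [f] grows by at least [d]. Running from [j] up to the last index gives
    [f j <= j], and from index 0 up to [j] gives [j <= f j]. *)
Lemma ord_increasing_id n (f : 'I_n -> 'I_n) :
  (forall i j : 'I_n, (i < j)%N -> (f i < f j)%N) -> f =1 id.
Proof.
move=> fi j.
have shift d : forall i k : 'I_n, (i + d = k)%N -> (f i + d <= f k)%N.
  elim: d => [|d IH] i k ik.
    by rewrite addn0 (_ : i = k)//; apply: val_inj; rewrite /= -ik addn0.
  have idn : (i + d < n)%N by apply: ltn_trans (ltn_ord k); rewrite -ik addnS.
  have := IH i (Ordinal idn) erefl; have := fi (Ordinal idn) k.
  rewrite -ik /= addnS leqnn => /(_ isT) h1 h2.
  by rewrite addnS; exact: leq_ltn_trans h2 h1.
have n0 : (0 < n)%N by apply: leq_ltn_trans (ltn_ord j).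
have nP : (n.-1 < n)%N by rewrite prednK.
have jn : (j <= n.-1)%N by rewrite -ltnS prednK.
apply: val_inj; apply/eqP; rewrite eqn_leq; apply/andP; split.
  have := shift (n.-1 - j)%N j (Ordinal nP) (subnKC jn).
  have : (f (Ordinal nP) <= n.-1)%N by rewrite -ltnS prednK.
  by move=> /[swap] /leq_trans /[apply]; rewrite -{2}(subnKC jn) leq_add2r.
have := shift j (Ordinal n0) j erefl; apply: leq_trans; exact: leq_addl.
Qed.

Section SpectralResolution.
Context {R : realType} {n : nat}.
Implicit Types (u : 'M[R[i]]_n) (th : 'I_n -> R) (P : 'I_n -> 'M[R[i]]_n).

(* Projections rather than eigenvectors: the phases of the [v k t] are arbitrary,
   so that the vectors themselves need not depend continuously on [t]. *)
Record spectral_resolution u th P : Prop := SpectralResolution {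
  sr_mul : forall j k, P j *m P k = if j == k then P k else 0;
  sr_sum : \sum_k P k = 1%:M;
  sr_tr : forall k, \tr (P k) = 1;
  sr_left : forall k, P k *m u = expi (th k) *: P k;
  sr_right : forall k, u *m P k = expi (th k) *: P k;
  sr_herm : forall k, (P k)^t* = P k;
  sr_le1 : forall k i j, `|P k i j| <= 1;
  sr_rank1 : forall k A, P k *m A *m P k = \tr (P k *m A) *: P k }.

Lemma l2norm_sqr (w : 'cV[R[i]]_n) : w^t* *m w = ((l2norm w ^+ 2)%:C%C)%:M.
Proof.
rewrite [LHS]mx11_scalar; congr _%:M.
rewrite /l2norm sqr_sqrtr; last by apply: sumr_ge0 => i _; exact: sqr_ge0.
rewrite rmorph_sum mxE; apply: eq_bigr => i _; rewrite !mxE rmorphXn.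
change (Num.conj (w i ord0) * w i ord0 = `|w i ord0| ^+ 2).
by rewrite normCK mulrC.
Qed.

Lemma eigenvector_resolution u th (v : 'I_n -> 'cV[R[i]]_n) :
  u \is unitarymx -> injective (fun k => expi (th k)) ->
  (forall k, l2norm (v k) = 1 /\ u *m v k = expi (th k) *: v k) ->
  spectral_resolution u th (fun k => v k *m (v k)^t*).
Proof.
move=> uu thI hv.
have v1 k : (v k)^t* *m v k = 1%:M.
  by rewrite l2norm_sqr (hv k).1 expr1n.
have vu k : (v k)^t* *m u = expi (th k) *: (v k)^t*.
  (* The adjoint of the eigenvector equation, multiplied by [u] on the right: unitarity removes [u],
     and the eigenvalue times its conjugate is 1. *)
  have /(congr1 (fun A => expi (th k) *: (A *m u))) :
      (u *m v k)^t* = Num.conj (expi (th k)) *: (v k)^t*.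
    by rewrite (hv k).2 linearZ /= map_mxZ.
  rewrite tC_mulmx -mulmxA (mulmx1C (unitarymxP uu)) mulmx1 => ->.
  by rewrite -scalemxAl scalerA expi_conj scale1r.
have vo j k : j != k -> (v j)^t* *m v k = 0.
  (* Letting [u] act to the left or to the right gives the same scalar product with two distinct
     eigenvalues in front. *)
  move=> jk; have := mulmxA ((v j)^t*) u (v k).
  rewrite vu (hv k).2 -scalemxAr -scalemxAl => /eqP.
  rewrite -subr_eq0 -scalerBl scaler_eq0 subr_eq0 => /orP[/eqP/thI|/eqP//].
  by move=> kj; rewrite kj eqxx in jk.
(* The columns of [V] are orthonormal and [V] is square, so its adjoint is also a right inverse;
   this yields completeness. *)
pose V := \matrix_(i, k) v k i 0.
have colV k : col k V = v k by apply/colP => i; rewrite !mxE.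
have VV : V *m V^t* = 1%:M.
  apply: mulmx1C; apply/matrixP => j k.
  have -> : (V^t* *m V) j k = ((v j)^t* *m v k) 0 0.
    by rewrite !mxE; apply: eq_bigr => i _; rewrite !mxE.
  by rewrite [RHS]mxE; case: (eqVneq j k) => [->|/vo ->]; rewrite ?v1 mxE.
split=> [j k||k|k|k|k|k i j|k A].
- rewrite mulmxA -(mulmxA (v j)); case: (eqVneq j k) => [->|/vo ->].
    by rewrite v1 mulmx1.
  by rewrite mulmx0 mul0mx.
- rewrite -VV; apply/matrixP => i j; rewrite summxE [RHS]mxE.
  by apply: eq_bigr => k _; rewrite !mxE big_ord1 !mxE.
- by rewrite mxtrace_mulC v1 mxtrace1.
- by rewrite -mulmxA vu scalemxAr.
- by rewrite mulmxA (hv k).2 scalemxAl.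
- by rewrite tC_mulmx trmxCK.
(* The squared modulus of one entry is a summand of the squared norm, which is 1. *)
- have vle a : `|v k a 0| <= 1.
    rewrite -(@ler_pXn2r _ 2)// ?nnegrE// expr1n.
    have /matrixP/(_ 0 0) := v1 k; rewrite !mxE eqxx mulr1n => <-.
    rewrite (bigD1 a)//= !mxE [Num.conj _ * _]mulrC -normCK lerDl.
    by apply: sumr_ge0 => b _; rewrite !mxE mulrC -normCK exprn_ge0.
  rewrite mxE big_ord1 !mxE normrM norm_conjC.
  by rewrite (le_trans (ler_piMr _ (vle j))).
- have -> : v k *m (v k)^t* *m A *m (v k *m (v k)^t*) =
      v k *m ((v k)^t* *m A *m v k) *m (v k)^t* by rewrite !mulmxA.
  rewrite [_ *m A *m v k]mx11_scalar mul_mx_scalar -scalemxAl; congr (_ *: _).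
  by rewrite -(mulmxA (v k)) mxtrace_mulC /mxtrace big_ord1.
Qed.

(** * Matrices that are diagonal in a single resolution *)

Section OneResolution.
Variables (u : 'M[R[i]]_n) (th : 'I_n -> R) (P : 'I_n -> 'M[R[i]]_n).
Hypothesis srP : spectral_resolution u th P.

(** Inserting the sum of all projections leaves only the diagonal block, which is a scalar because
    the projections have rank one. *)
Lemma resolution_diag (A : 'M[R[i]]_n) :
  (forall j k, j != k -> P j *m A *m P k = 0) ->
  forall k, A *m P k = \tr (P k *m A) *: P k /\ P k *m A = \tr (P k *m A) *: P k.
Proof.
move=> A0 k; split.
  rewrite -[LHS]mul1mx -(sr_sum srP) mulmx_suml (bigD1 k)//= mulmxA.
  rewrite big1 ?addr0 ?(sr_rank1 srP)// => j jk.
  by rewrite mulmxA A0.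
rewrite -[LHS]mulmx1 -(sr_sum srP) mulmx_sumr (bigD1 k)//=.
rewrite big1 ?addr0 ?(sr_rank1 srP)// => j jk.
by rewrite A0// eq_sym.
Qed.

(** Sandwiching [A *m u = u *m A] between [P j] and [P k] multiplies the same block by two distinct
    eigenvalues. *)
Lemma resolution_comm_diag (A : 'M[R[i]]_n) : injective (fun k => expi (th k)) ->
  A *m u = u *m A -> forall j k, j != k -> P j *m A *m P k = 0.
Proof.
move=> thI Au j k jk.
have : P j *m (A *m u) *m P k = P j *m (u *m A) *m P k by rewrite Au.
rewrite mulmxA -(mulmxA _ u) (sr_right srP) -scalemxAr.
rewrite mulmxA (sr_left srP) -!scalemxAl => /eqP.
rewrite -subr_eq0 -scalerBl scaler_eq0 subr_eq0 => /orP[/eqP/thI|/eqP//].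
by move=> kj; rewrite kj eqxx in jk.
Qed.

Lemma resolution_diag_comm (A B : 'M[R[i]]_n) :
  (forall j k, j != k -> P j *m A *m P k = 0) ->
  (forall j k, j != k -> P j *m B *m P k = 0) -> A *m B = B *m A.
Proof.
move=> /resolution_diag dA /resolution_diag dB.
rewrite -[A *m B]mulmx1 -[B *m A]mulmx1 -(sr_sum srP) !mulmx_sumr.
apply: eq_bigr => k _; rewrite -!mulmxA (dA k).1 (dB k).1 -!scalemxAr.
by rewrite (dA k).1 (dB k).1 !scalerA mulrC.
Qed.

Lemma resolution_diag_u j k : j != k -> P j *m u *m P k = 0.
Proof.
by move=> jk; rewrite (sr_left srP) -scalemxAl (sr_mul srP) (negbTE jk) scaler0.
Qed.

End OneResolution.

(** Both factors are Hermitian idempotents, so the overlap is the squared Hilbert-Schmidt norm of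
    their product. *)
Lemma mxtrace_resolution2_ge0 u th P u' th' P' j k :
  spectral_resolution u th P -> spectral_resolution u' th' P' ->
  0 <= \tr (P j *m P' k).
Proof.
move=> sr sr'; suff -> : \tr (P j *m P' k) = \tr ((P j *m P' k) *m (P j *m P' k)^t*).
  exact: mxtrace_mul_tC_ge0.
rewrite tC_mulmx (sr_herm sr) (sr_herm sr') mulmxA -(mulmxA _ (P' k) (P' k)).
by rewrite (sr_mul sr') eqxx [RHS]mxtrace_mulC mulmxA (sr_mul sr) eqxx.
Qed.

Lemma resolution_perturbation u th P u' th' P' j k :
  spectral_resolution u th P -> spectral_resolution u' th' P' ->
  P j *m (u' - u) *m P' k =
    (expi (th' k) - expi (th j)) *: (P j *m P' k).
Proof.
move=> sr sr'.
rewrite mulmxBr mulmxBl -mulmxA (sr_right sr') (sr_left sr).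
by rewrite -scalemxAr -scalemxAl scalerBl.
Qed.

(** Some overlap is at least 1/n. The trace of the perturbation identity then bounds the eigenvalue
    difference, the entries of [P' k] being at most 1 in modulus; the bound thus involves only [P j]
    and [u' - u]. *)
Lemma near_eigenvalue u th P u' th' P' j :
  spectral_resolution u th P -> spectral_resolution u' th' P' ->
  exists k, `|expi (th' k) - expi (th j)| <=
    n%:R * \sum_a \sum_b `|(P j *m (u' - u)) a b|.
Proof.
move=> sr sr'.
have n0 : (0 < n)%N by apply: leq_ltn_trans (ltn_ord j).
have sum1 : \sum_k \tr (P j *m P' k) = 1.
  by rewrite -linear_sum /= -mulmx_sumr (sr_sum sr') mulmx1 (sr_tr sr).
(* The n overlaps [\tr (P j *m P' k)] are nonnegative and sum to 1. *)
have [k k1] : exists k, 1 <= n%:R * \tr (P j *m P' k).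
  apply/existsP; rewrite -[X in is_true X]negbK negb_exists; apply/negP => /forallP nk.
  have : \sum_k n%:R * \tr (P j *m P' k) < \sum_(k < n) 1.
    apply: ltr_sum; last first.
      move=> k _; have := nk k.
      rewrite real_leNgt ?negbK ?real1// ger0_real// mulr_ge0//.
      exact: mxtrace_resolution2_ge0 sr sr'.
    by apply/hasP; exists j => //; rewrite mem_index_enum.
  by rewrite -mulr_sumr sum1 mulr1 sumr_const card_ord ltxx.
exists k; have T0 := mxtrace_resolution2_ge0 j k sr sr'.
apply: (@le_trans _ _ (n%:R * \tr (P j *m P' k) * `|expi (th' k) - expi (th j)|)).
  by rewrite ler_peMl.
rewrite -mulrA; apply: ler_wpM2l => //.
rewrite -[\tr _]ger0_norm// -normrM mulrC -mxtraceZ -(resolution_perturbation _ _ sr sr').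
rewrite (le_trans (ler_norm_sum _ _ _))//; apply: ler_sum => a _.
rewrite mxE (le_trans (ler_norm_sum _ _ _))//; apply: ler_sum => b _.
by rewrite normrM ler_piMr// (sr_le1 sr').
Qed.

Lemma Im_le_norm (z : R[i]) (e : R) : `|z| <= e%:C%C -> `|complex.Im z| <= e.
Proof.
move=> ze; rewrite -lecR (le_trans _ ze)//.
have := normc_ge_Re (z * 'i%C); rewrite ReiNIm normrN normrM.
rewrite [`|'i%C|](_ : _ = 1) ?mulr1//.
by rewrite normc_def /= expr0n expr1n add0r sqrtr1.
Qed.

(** Eigenvalues are compared through their imaginary parts, which are linearly ordered. A choice
    failing to increase on [i < j] would bring the sines at [i] and [j] within [e i + e j] of each
    other. *)
Lemma eigenvalue_matching th th' (e : 'I_n -> R) :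
  (forall i j : 'I_n, (i < j)%N -> e i + e j < sin (th i) - sin (th j)) ->
  (forall i j : 'I_n, (i < j)%N -> sin (th' j) < sin (th' i)) ->
  (forall j, exists k, `|expi (th' k) - expi (th j)| <= (e j)%:C%C) ->
  forall j, `|expi (th' j) - expi (th j)| <= (e j)%:C%C.
Proof.
move=> gap dec near.
(* The gap makes the choice of a nearby eigenvalue strictly increasing. *)
have [f fP] := choice near.
suff fid : f =1 id by move=> j; rewrite -{1}[j]fid.
apply: ord_increasing_id => i j ij; rewrite ltnNge; apply/negP => fji.
have si := Im_le_norm (fP i); have sj := Im_le_norm (fP j).
rewrite /expi /= in si sj.
have : sin (th' (f i)) <= sin (th' (f j)).
  move: fji; rewrite leq_eqVlt => /orP[/eqP/val_inj -> //|/dec/ltW //].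
move: si sj (gap i j ij); rewrite !ler_norml => /andP[a1 a2] /andP[b1 b2].
lra.
Qed.

End SpectralResolution.

(** * Derivatives of the eigenvalues *)

Section SlopesWithin.
Context {R : realType}.

(** The chain rule along an arbitrary filter, hence also for one-sided slopes. *)
Lemma slope_comp (F : set_system R) {FF : Filter F} (f g : R -> R) (t df dg : R) :
  is_derive (g t) 1 f df ->
  g h @[h --> F] --> g t ->
  (h - t)^-1 * (g h - g t) @[h --> F] --> dg ->
  (h - t)^-1 * (f (g h) - f (g t)) @[h --> F] --> df * dg.
Proof.
move=> fd gt gd.
(* The difference quotient of [f], extended by the derivative at [g t]; it stays meaningful at those
   [h] where [g h = g t]. *)
pose phi z := if z == g t then df else (z - g t)^-1 * (f z - f (g t)).
have phi_cvg : phi z @[z --> g t] --> df.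
  move=> A Adf; have := is_derive_slope fd Adf => /nbhs_ballP[e /= e0 eA].
  apply/nbhs_ballP; exists e => //= z ze; rewrite /phi /=.
  case: (eqVneq z (g t)) => [_|zg]; first by exact: (nbhs_singleton Adf).
  exact: eA.
have -> : (fun h => (h - t)^-1 * (f (g h) - f (g t))) =
    (fun h => phi (g h) * ((h - t)^-1 * (g h - g t))).
  apply/funext => h; rewrite /phi; case: (eqVneq (g h) (g t)) => [->|gh].
    by rewrite !subrr !mulr0.
  have : g h - g t != 0 by rewrite subr_eq0.
  by move: (g h - g t) (h - t)^-1 => p y p0; field.
apply: (@cvgM R); last exact: gd.
exact: (cvg_comp _ _ gt phi_cvg).
Qed.

Lemma within_itv_dnbhs_proper (t0 t : R) : 0 < t0 -> 0 <= t <= t0 ->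
  ProperFilter (within `[0, t0] t^').
Proof.
move=> t0_gt0 /andP[t_ge0 t_le].
apply: Build_ProperFilter_ex => P /nbhs_ballP[e /= e0 eP].
(* A point of the interval other than [t] is found to the right of [t], or to the left when
   [t = t0]; the minimum keeps it inside the interval. *)
have [tt0|tt0] := ltrP t t0.
  pose d := Num.min e (t0 - t).
  have d0 : 0 < d by rewrite lt_min e0 subr_gt0.
  have de : d <= e by rewrite ge_min lexx.
  have dt : d <= t0 - t by rewrite ge_min lexx orbT.
  exists (t + d / 2); apply: eP.
  - by rewrite /ball /= opprD addNKr normrN gtr0_norm ?divr_gt0//; lra.
  - by apply/eqP; lra.
  - by rewrite /= in_itv /=; apply/andP; split; lra.
pose d := Num.min e t0.
have d0 : 0 < d by rewrite lt_min e0.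
have de : d <= e by rewrite ge_min lexx.
have dt : d <= t0 by rewrite ge_min lexx orbT.
exists (t - d / 2); apply: eP.
- by rewrite /ball /= subKr gtr0_norm ?divr_gt0//; lra.
- by apply/eqP; lra.
- by rewrite /= in_itv /=; apply/andP; split; lra.
Qed.

Lemma derive1_withinE (D : set R) (f : R -> R) (t l : R) :
  ProperFilter (within D t^') ->
  (h - t)^-1 * (f h - f t) @[h --> within D t^'] --> l ->
  derive1_within D f t = l.
Proof. by move=> PF fl; apply: cvg_lim. Qed.

(** Antisymmetry cancels the terms with both indices below [m]. What remains is a vanishing sum of
    nonnegative terms crossing the cut at [m]. *)
Lemma antisymmetric_flux n (a : 'I_n -> 'I_n -> R) (m : nat) :
  (forall k j, a j k = - a k j) ->
  (forall k j : 'I_n, (k < j)%N -> 0 <= a k j) ->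
  \sum_(k < n | (k < m)%N) \sum_j a k j = 0 ->
  forall k j : 'I_n, (k < m)%N -> (m <= j)%N -> a k j = 0.
Proof.
move=> anti pos sum0 k j km mj.
have inner : \sum_(k < n | (k < m)%N) \sum_(j < n | (j < m)%N) a k j = 0.
  have : \sum_(k < n | (k < m)%N) \sum_(j < n | (j < m)%N) a k j =
      - \sum_(k < n | (k < m)%N) \sum_(j < n | (j < m)%N) a k j.
    rewrite {1}exchange_big /= -sumrN; apply: eq_bigr => i _.
    by rewrite -sumrN; apply: eq_bigr => l _; rewrite anti.
  lra.
have outer0 : \sum_(k < n | (k < m)%N) \sum_(j < n | ~~ (j < m)%N) a k j = 0.
  rewrite -[RHS]sum0 -[LHS]add0r -{1}inner -big_split /=; apply: eq_bigr => i _.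
  by rewrite [RHS](bigID (fun j : 'I_n => (j < m)%N)).
have outer_ge0 (i l : 'I_n) : (i < m)%N -> ~~ (l < m)%N -> 0 <= a i l.
  by move=> im lm; apply: pos; rewrite (leq_trans im)// leqNgt.
move/eqP: outer0; rewrite psumr_eq0; last first.
  by move=> i im; apply: sumr_ge0 => l; exact: outer_ge0.
move=> /allP/(_ k (mem_index_enum k)); rewrite km /= psumr_eq0; last first.
  by move=> l; exact: outer_ge0.
by move=> /allP/(_ j (mem_index_enum j)); rewrite -leqNgt mj => /eqP.
Qed.

End SlopesWithin.

(* Both sides are cot((a - b) / 2). *)
Lemma expi_flux {R : realType} (a b : R) : expi a - expi b != 0 ->
  'i%C * (expi a + expi b) / (expi a - expi b) =
  (2 * sin (a - b) / ((cos a - cos b) ^+ 2 + (sin a - sin b) ^+ 2))%:C%C.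
Proof.
move=> ab; have nz : (cos a - cos b) ^+ 2 + (sin a - sin b) ^+ 2 != 0.
  apply: contra ab; rewrite paddr_eq0 ?sqr_ge0// !sqrf_eq0 => /andP[/eqP c0 /eqP s0].
  by rewrite /expi; simpc; rewrite c0 s0.
have split_expi (p q : R) : (p +i* q)%C = p%:C%C + 'i%C * q%:C%C by simpc.
apply: (mulIf ab); rewrite divfK//.
have ca := cos2Dsin2 a; have cb := cos2Dsin2 b.
rewrite /expi sinB; simpc; apply/eqP; rewrite eq_complex /=; apply/andP; split; apply/eqP.
  apply: (mulfI nz); rewrite mulrA [X in _ = X * _]mulrC divfK//.
  apply/eqP; rewrite -subr_eq0.
  (* With the denominator cleared, the difference of the two sides is a combination of the
     Pythagorean relations for [a] and [b]. *)
  rewrite (_ : _ - _ = (cos a ^+ 2 + sin a ^+ 2 - 1) * (sin b - sin a) +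
    (cos b ^+ 2 + sin b ^+ 2 - 1) * (sin a - sin b)); last by ring.
  by rewrite ca cb subrr !mul0r addr0.
apply: (mulfI nz); rewrite mulrA [X in _ = X * _]mulrC divfK//.
apply/eqP; rewrite -subr_eq0.
rewrite (_ : _ - _ = (cos a ^+ 2 + sin a ^+ 2 - 1) * (cos a - cos b) +
  (cos b ^+ 2 + sin b ^+ 2 - 1) * (cos b - cos a)); last by ring.
by rewrite ca cb subrr !mul0r addr0.
Qed.

Section Perturbation.
Context {R : realType} {n : nat}.
Local Notation C := (R[i] : numFieldType).
Variables (x : 'M[R[i]]_n) (t0 : R) (u : R -> 'M[R[i]]_n).
Variables (th : 'I_n -> R -> R) (P : 'I_n -> R -> 'M[R[i]]_n).
Hypothesis x_herm : x^t* = x.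
Hypothesis t0_gt0 : 0 < t0.
Hypothesis srP : forall t, 0 <= t <= t0 ->
  spectral_resolution (u t) (th^~ t) (P^~ t).
Hypothesis th_inj : forall t, 0 <= t <= t0 -> injective (fun k => expi (th k t)).
Hypothesis th_bound : forall t, 0 <= t <= t0 -> forall k,
  - (pi / 2) < th k t < pi / 2.
Hypothesis th_dec : forall t, 0 <= t <= t0 ->
  forall j k : 'I_n, (j < k)%N -> th k t < th j t.
Hypothesis u_slope : forall t,
  (h - t)^-1%:C%C *: (u h - u t) @[h --> t^'] --> (('i%C *: x) *m u t : 'M[C]_n).

Lemma sin_th_dec t : 0 <= t <= t0 ->
  forall j k : 'I_n, (j < k)%N -> sin (th k t) < sin (th j t).
Proof.
move=> Dt j k jk; have /andP[a1 a2] := th_bound Dt k; have /andP[b1 b2] := th_bound Dt j.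
have jk' := th_dec Dt jk.
have diff p q : sin (p + q) - sin (p - q) = 2 * sin q * cos p :> R.
  by rewrite sinD sinB; ring.
rewrite -subr_gt0.
(* The half difference lies in (0, pi/2) and the half sum in (-pi/2, pi/2), so both factors of the
   product are positive. *)
have := diff ((th j t + th k t) / 2) ((th j t - th k t) / 2).
rewrite (_ : _ / 2 + _ / 2 = th j t); last by lra.
rewrite (_ : _ / 2 - _ / 2 = th k t); last by lra.
move=> ->.
have pi0 := pi_gt0 R.
apply: mulr_gt0; first apply: mulr_gt0 => //.
  by apply: sin_gt0_pihalf; apply/andP; split; lra.
by apply: cos_gt0_pihalf; apply/andP; split; lra.
Qed.

(** * Continuity and first-order slopes at a fixed time *)

Section AtPoint.
Variable t : R.
Hypothesis Dt : 0 <= t <= t0.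
Local Notation F := (within `[0, t0] t^').
Local Notation lam k h := (expi (th k h)).

Let FF : ProperFilter F. Proof. exact: within_itv_dnbhs_proper. Qed.

Let srt := srP Dt.

Lemma near_domain : \forall h \near F, 0 <= h <= t0.
Proof.
by rewrite near_withinE; apply: nearW => h /=; rewrite in_itv.
Qed.

Let near_sr : \forall h \near F, spectral_resolution (u h) (th^~ h) (P^~ h).
Proof. by apply: filterS near_domain => h /srP. Qed.

Let u_slopeF :
  (h - t)^-1%:C%C *: (u h - u t) @[h --> F] --> (('i%C *: x) *m u t : 'M[C]_n).
Proof. by apply: cvg_trans (@u_slope t); apply: cvg_app; exact: cvg_within. Qed.

Let idF : (h - t)%:C%C @[h --> F] --> (0 : C).
Proof.
apply: (@cvg_real_complex _ _ _ _ (fun h => h - t) 0).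
have idt : (h - t) @[h --> t] --> (0 : R).
  by rewrite -[X in _ --> X](subrr t); apply: (@cvgB R R^o);
    [exact: cvg_id|exact: cvg_cst].
apply: cvg_trans idt; apply: cvg_app; apply: cvg_trans (cvg_within _).
exact: cvg_within.
Qed.

Let near_neq : \forall h \near F, h != t.
Proof.
rewrite near_withinE; have := nbhs_dnbhs_neq t.
by apply: filterS => h ht _.
Qed.

Lemma u_cvg0 : (u h - u t) @[h --> F] --> (0 : 'M[C]_n).
Proof.
rewrite -(scale0r (('i%C *: x) *m u t : 'M[C]_n)).
apply: cvg_trans (cvgZ idF u_slopeF); apply: near_eq_cvg.
apply: filterS near_neq => h ht.
by rewrite scalerA -rmorphM /= mulfV ?subr_eq0// scale1r.
Qed.

(** The bounds of [near_eigenvalue] tend to 0, so near [t] they fall below all gaps between the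
    sines at [t]; the matching then pairs each eigenvalue with the one of the same index. *)
Lemma lam_cvg j : lam j h @[h --> F] --> (lam j t : C).
Proof.
(* Norms of complex matrices take values in the complex field; the real part loses nothing, as the
   quantity is real and nonnegative. *)
pose e j h : R := complex.Re (n%:R * \sum_a \sum_b `|(P j t *m (u h - u t)) a b|).
have eE i h : (e i h)%:C%C = n%:R * \sum_a \sum_b `|(P i t *m (u h - u t)) a b|.
  rewrite RRe_real// ger0_real// mulr_ge0// sumr_ge0// => a _.
  by rewrite sumr_ge0.
have e0 i : (e i h)%:C%C @[h --> F] --> (0 : C).
  have Pu0 : P i t *m (u h - u t) @[h --> F] --> (0 : 'M[C]_n).
    exact: cvg_mulmx_r0 u_cvg0.
  have S0 : \sum_a \sum_b `|(P i t *m (u h - u t)) a b| @[h --> F] -->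
      (\sum_(a < n) \sum_(b < n) `|(0 : 'M[C]_n) a b| : C^o).
    apply: (@cvg_bigsum C _ F _ C^o) => a _.
    apply: (@cvg_bigsum C _ F _ C^o) => b _.
    have ab : (P i t *m (u h - u t)) a b @[h --> F] --> ((0 : 'M[C]_n) a b : C^o).
      by move/cvg_mxP : Pu0; apply.
    exact: (@cvg_norm C C^o _ F _ _ _ ab).
  have nS : n%:R * \sum_a \sum_b `|(P i t *m (u h - u t)) a b| @[h --> F] -->
      (n%:R * \sum_(a < n) \sum_(b < n) `|(0 : 'M[C]_n) a b| : C).
    by apply: (@cvgM C); [exact: cvg_cst|exact: S0].
  move: nS; rewrite [\sum_(a < n) _ in X in _ --> X]big1 ?mulr0; last first.
    by move=> a _; rewrite big1// => b _; rewrite mxE normr0.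
  by under [fun h => n%:R * _]eq_fun do rewrite -eE.
have eR i : e i h @[h --> F] --> (0 : R) by have [] := cvg_Re_Im (e0 i).
have gap : \forall h \near F, forall ij : 'I_n * 'I_n, (ij.1 < ij.2)%N ->
    e ij.1 h + e ij.2 h < sin (th ij.1 t) - sin (th ij.2 t).
  apply: filter_forall => -[i k] /=.
  have [ik|] := boolP (i < k)%N; last by move=> _; apply: nearW.
  have gap0 : 0 < sin (th i t) - sin (th k t) by rewrite subr_gt0 sin_th_dec.
  have ek : e i h + e k h @[h --> F] --> (0 : R^o).
    have := @cvgD R R^o _ F FF _ _ _ _ (eR i) (eR k).
    by rewrite addr0.
  have := (@cvgr0Pnorm_lt R R^o _ F FF _).1 ek _ gap0.
  by apply: filterS => h + _; apply: le_lt_trans; exact: ler_norm.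
have close : \forall h \near F, `|lam j h - lam j t : C^o| <= (e j h)%:C%C.
  apply: filterS3 near_domain near_sr gap => h Dh srh gaph.
  apply: (@eigenvalue_matching _ _ (th^~ t) (th^~ h) (e^~ h)) => [i k ik||i].
  - exact: (gaph (i, k)).
  - exact: sin_th_dec.
  - by rewrite eE; exact: (near_eigenvalue i srt srh).
have : lam j h - lam j t @[h --> F] --> (0 : C^o).
  exact: (@cvg0_le_norm C _ F FF C^o _ (fun h => (e j h)%:C%C) close (e0 j)).
exact: (@subr_cvg0 C C^o _ F FF (fun h => lam j h) (lam j t)).1.
Qed.

Lemma lam_neq j k : j != k -> lam k t - lam j t != 0.
Proof.
by apply: contra_neq => /eqP; rewrite subr_eq0 => /eqP /(th_inj Dt).
Qed.

Let lam_subV j k : j != k ->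
  (lam k h - lam j t)^-1 @[h --> F] --> ((lam k t - lam j t)^-1 : C).
Proof.
move=> jk; apply: (@cvgV C _ F FF (fun h => lam k h - lam j t)); first exact: lam_neq.
exact: (@cvgB C C^o _ F FF _ _ _ _ (@lam_cvg k) (cvg_cst _)).
Qed.

Let near_lam_neq j k : j != k -> \forall h \near F, lam k h - lam j t != 0.
Proof.
move=> jk.
have : lam k h - lam j t @[h --> F] --> (lam k t - lam j t : C^o).
  exact: (@cvgB C C^o _ F FF _ _ _ _ (@lam_cvg k) (cvg_cst _)).
by move=> /(@cvgr_neq0 C C^o _ _ FF _ _); apply; exact: lam_neq.
Qed.

Let offdiagE j k : j != k -> \forall h \near F,
  P j t *m P k h = (lam k h - lam j t)^-1 *: (P j t *m (u h - u t) *m P k h).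
Proof.
move=> jk; apply: filterS2 near_sr (near_lam_neq jk) => h srh l0.
by rewrite (resolution_perturbation j k srt srh) scalerA mulVf// scale1r.
Qed.

(** In the divided perturbation identity the inverse eigenvalue gap converges, [u h - u t] tends to
    0 and [P k h] is bounded. *)
Lemma offdiag_cvg0 j k : j != k -> P j t *m P k h @[h --> F] --> (0 : 'M[C]_n).
Proof.
move=> jk; rewrite -(scaler0 _ (lam k t - lam j t)^-1).
suff : (lam k h - lam j t)^-1 *: (P j t *m (u h - u t) *m P k h)
    @[h --> F] --> ((lam k t - lam j t)^-1 *: 0 : 'M[C]_n).
  apply: cvg_trans; apply: near_eq_cvg.
  by apply: filterS (offdiagE jk) => h ->.
apply: cvgZ; first exact: lam_subV.
apply: cvg0_mulmx_bounded; first exact: cvg_mulmx_r0 u_cvg0.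
by apply: filterS near_sr => h srh; exact: (sr_le1 srh k).
Qed.

(** From P' - P = (1 - P) P' - P (1 - P'), with both complements expanded into the other
    projections. Only off-diagonal products remain, and these carry the eigenvalue gap. *)
Let increment k : \forall h \near F,
  P k h - P k t = \sum_(j | j != k) (P j t *m P k h - P k t *m P j h).
Proof.
apply: filterS near_sr => h srh; rewrite big_split /= sumrN.
rewrite -mulmx_suml -mulmx_sumr.
have -> : \sum_(j | j != k) P j t = 1%:M - P k t.
  by rewrite -(sr_sum srt) [in RHS](bigD1 k)//= [RHS]addrC addKr.
have -> : \sum_(j | j != k) P j h = 1%:M - P k h.
  by rewrite -(sr_sum srh) [in RHS](bigD1 k)//= [RHS]addrC addKr.
by rewrite mulmxBl mulmxBr mul1mx mulmx1 opprB addrA subrK.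
Qed.

Lemma proj_cvg k : P k h @[h --> F] --> (P k t : 'M[C]_n).
Proof.
have : P k h - P k t @[h --> F] --> (0 : 'M[C]_n).
  have -> : (0 : 'M[C]_n) = \sum_(j < n | j != k) (0 - 0).
    by rewrite big1// => j _; rewrite subr0.
  have := @cvg_bigsum C _ F FF 'M[C]_n _ (index_enum 'I_n) (fun j => j != k)
    (fun j h => P j t *m P k h - P k t *m P j h) (fun=> 0 - 0).
  move=> /(_ _)/wrap[j jk|].
    by apply: cvgB; apply: offdiag_cvg0; rewrite // eq_sym.
  apply: cvg_trans; apply: near_eq_cvg.
  by apply: filterS (increment k) => h ->.
exact: (@subr_cvg0 C 'M[C]_n _ F FF (P k) (P k t)).1.
Qed.

Lemma offdiag_slope j k : j != k ->
  (h - t)^-1%:C%C *: (P j t *m P k h) @[h --> F] -->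
  ((lam k t - lam j t)^-1 *: (P j t *m (('i%C *: x) *m u t) *m P k t) : 'M[C]_n).
Proof.
move=> jk.
suff : (lam k h - lam j t)^-1 *:
    (P j t *m ((h - t)^-1%:C%C *: (u h - u t)) *m P k h) @[h --> F] -->
    ((lam k t - lam j t)^-1 *: (P j t *m (('i%C *: x) *m u t) *m P k t) : 'M[C]_n).
  apply: cvg_trans; apply: near_eq_cvg.
  apply: filterS (offdiagE jk) => h ->.
  by rewrite -scalemxAr -scalemxAl !scalerA mulrC.
apply: cvgZ; first exact: lam_subV.
apply: cvg_mulmx; last exact: proj_cvg.
by apply: cvg_mulmx; [exact: cvg_cst|exact: u_slopeF].
Qed.

Lemma proj_slope k : (h - t)^-1%:C%C *: (P k h - P k t) @[h --> F] -->
  (\sum_(j | j != k)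
    ((lam k t - lam j t)^-1 *: (P j t *m (('i%C *: x) *m u t) *m P k t) -
     (lam j t - lam k t)^-1 *: (P k t *m (('i%C *: x) *m u t) *m P j t)) : 'M[C]_n).
Proof.
have := @cvg_bigsum C _ F FF 'M[C]_n _ (index_enum 'I_n) (fun j => j != k)
  (fun j h => (h - t)^-1%:C%C *: (P j t *m P k h) - (h - t)^-1%:C%C *: (P k t *m P j h))
  (fun j => (lam k t - lam j t)^-1 *: (P j t *m (('i%C *: x) *m u t) *m P k t) -
     (lam j t - lam k t)^-1 *: (P k t *m (('i%C *: x) *m u t) *m P j t)).
move=> /(_ _)/wrap[j jk|].
  by apply: cvgB; apply: offdiag_slope; rewrite // eq_sym.
apply: cvg_trans; apply: near_eq_cvg.
apply: filterS (increment k) => h ->; rewrite scaler_sumr; apply: eq_bigr => j _.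
by rewrite scalerBr.
Qed.

(** The trace of the perturbation identity with [j = k] is divided by the overlap of [P k t] and
    [P k h], which tends to 1. *)
Lemma lam_slope k : (h - t)^-1%:C%C * (lam k h - lam k t) @[h --> F] -->
  ('i%C * lam k t * \tr (P k t *m x) : C).
Proof.
have tr_cvg : \tr (P k t *m P k h) @[h --> F] --> (1 : C).
  have -> : (1 : C) = \tr (P k t *m P k t) by rewrite (sr_mul srt) eqxx (sr_tr srt).
  by apply: cvg_mxtrace; apply: cvg_mulmx; [exact: cvg_cst|exact: proj_cvg].
have tr_neq0 : \forall h \near F, \tr (P k t *m P k h) != 0.
  by move: tr_cvg => /(@cvgr_neq0 C C^o _ _ FF _ _); apply; exact: oner_neq0.
have : (\tr (P k t *m P k h))^-1 *
    \tr (P k t *m ((h - t)^-1%:C%C *: (u h - u t)) *m P k h) @[h --> F] -->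
    (1^-1 * \tr (P k t *m (('i%C *: x) *m u t) *m P k t) : C).
  apply: (@cvgM C); first by apply: (@cvgV C) => //; exact: oner_neq0.
  apply: cvg_mxtrace; apply: cvg_mulmx; last exact: proj_cvg.
  by apply: cvg_mulmx; [exact: cvg_cst|exact: u_slopeF].
rewrite invr1 mul1r.
have -> : \tr (P k t *m ('i%C *: x *m u t) *m P k t) = 'i%C * lam k t * \tr (P k t *m x).
  rewrite mulmxA -(mulmxA _ (u t)) (sr_right srt) -scalemxAr -scalemxAr -scalemxAl.
  rewrite !mxtraceZ [X in _ * (_ * X)]mxtrace_mulC mulmxA (sr_mul srt) eqxx.
  by rewrite mulrCA mulrA.
apply: cvg_trans; apply: near_eq_cvg.
apply: filterS2 near_sr tr_neq0 => h srh trh.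
rewrite -scalemxAr -scalemxAl mxtraceZ (resolution_perturbation k k srt srh) mxtraceZ.
by rewrite mulrCA mulrC [_ * \tr _]mulrC mulKf// mulrC.
Qed.

Lemma tr_projx_real k : (complex.Re (\tr (P k t *m x)))%:C%C = \tr (P k t *m x).
Proof.
rewrite RRe_real//; apply/CrealP.
rewrite -[in LHS]x_herm -[in LHS](sr_herm srt k) -tC_mulmx.
by rewrite trace_map_mx mxtrace_tr conjCK mxtrace_mulC.
Qed.

Lemma derive1_th k :
  derive1_within `[0, t0] (th k) t = complex.Re (\tr (P k t *m x)).
Proof.
apply: (derive1_withinE FF).
set tau := complex.Re _.
have sin_slope : (h - t)^-1 * (sin (th k h) - sin (th k t)) @[h --> F] -->
    cos (th k t) * tau.
  have [_] := cvg_Re_Im (@lam_slope k).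
  rewrite -tr_projx_real -/tau /expi.
  have -> : complex.Im ('i%C * (cos (th k t) +i* sin (th k t))%C * tau%:C%C) =
     cos (th k t) * tau by simpc.
  by under eq_fun do simpc.
have sin_cvg : sin (th k h) @[h --> F] --> sin (th k t).
  by have [_] := cvg_Re_Im (@lam_cvg k).
have cos0 : 0 < cos (th k t) by apply: cos_gt0_pihalf; exact: th_bound.
have sin2 : -1 < sin (th k t) < 1.
  have : 0 < cos (th k t) ^+ 2 by rewrite exprn_gt0.
  rewrite cos2sin2 subr_gt0 => sin1.
  by rewrite -ltr_norml -(@ltr_pXn2r _ 2)// ?nnegrE// expr1n real_normK ?num_real.
(* The angle is recovered from the imaginary part of the eigenvalue. *)
have asin_sin h : 0 <= h <= t0 -> asin (sin (th k h)) = th k h.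
  move=> Dh; apply: sinK; rewrite in_itv /=.
  by have /andP[/ltW -> /ltW ->] := th_bound Dh k.
have := @slope_comp _ F FF _ _ _ _ _ (is_derive1_asin sin2) sin_cvg sin_slope.
(* The root equals the cosine, which is positive here, so the derivative of [asin] cancels the
   factor from the slope of the sine. *)
have -> : (Num.sqrt (1 - sin (th k t) ^+ 2))^-1 * (cos (th k t) * tau) = tau.
  by rewrite -cos2sin2 sqrtr_sqr gtr0_norm// mulKf// gt_eqF.
apply: cvg_trans; apply: near_eq_cvg.
by apply: filterS near_domain => h Dh; rewrite !asin_sin.
Qed.

End AtPoint.

(** The cotangent of half the angle difference, in a form that is 0 for [j = k], so that sums may
    run over all [j]. *)
Local Notation flux t k j :=
  (2 * sin (th k t - th j t) /
    ((cos (th k t) - cos (th j t)) ^+ 2 + (sin (th k t) - sin (th j t)) ^+ 2)).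
Local Notation coupling t k j := (\tr (P j t *m x *m P k t *m x)).

(** As a squared Hilbert-Schmidt norm, the coupling is nonnegative and vanishes only if the block
    [P j t *m x *m P k t] does. *)
Lemma couplingE t (Dt : 0 <= t <= t0) j k :
  coupling t k j = \tr ((P j t *m x *m P k t) *m (P j t *m x *m P k t)^t*).
Proof.
rewrite !tC_mulmx x_herm !(sr_herm (srP Dt)) !mulmxA -(mulmxA _ (P k t) (P k t)).
rewrite (sr_mul (srP Dt)) eqxx [RHS]mxtrace_mulC !mulmxA.
by rewrite (sr_mul (srP Dt)) eqxx.
Qed.

Lemma coupling_ge0 t (Dt : 0 <= t <= t0) j k : 0 <= coupling t k j.
Proof. by rewrite couplingE// mxtrace_mul_tC_ge0. Qed.

Lemma couplingC t j k : coupling t k j = coupling t j k.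
Proof. by rewrite -mulmxA [LHS]mxtrace_mulC mulmxA. Qed.

(** The first derivative is the real part of [\tr (P k t *m x)], so the slope of the projection is
    inserted into this trace. *)
Lemma derive2_th t (Dt : 0 <= t <= t0) k :
  derive1_within `[0, t0] (derive1_within `[0, t0] (th k)) t =
  \sum_j flux t k j * complex.Re (coupling t k j).
Proof.
have FF := within_itv_dnbhs_proper t0_gt0 Dt.
set F := within `[0, t0] t^' in FF *.
apply: (derive1_withinE FF).
pose L := \tr ((\sum_(j | j != k)
    ((expi (th k t) - expi (th j t))^-1 *: (P j t *m (('i%C *: x) *m u t) *m P k t) -
     (expi (th j t) - expi (th k t))^-1 *: (P k t *m (('i%C *: x) *m u t) *m P j t))) *m x).
have LE : L = (\sum_j flux t k j * complex.Re (coupling t k j))%:C%C.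
  rewrite /L mulmx_suml linear_sum /= rmorph_sum /= [RHS](bigD1 k)//=.
  rewrite subrr sin0 mulr0 !mul0r add0r.
  apply: eq_bigr => j jk; rewrite rmorphM /= RRe_real; last first.
    exact: ger0_real (coupling_ge0 Dt j k).
  have lamkj : expi (th k t) - expi (th j t) != 0 by exact: (lam_neq Dt jk).
  rewrite -expi_flux//.
  have uP i : u t *m P i t = expi (th i t) *: P i t by exact: (sr_right (srP Dt)).
  have trE a b : \tr (P a t *m ('i%C *: x *m u t) *m P b t *m x) =
      'i%C * expi (th b t) * coupling t b a.
    rewrite mulmxA -(mulmxA _ (u t)) uP -scalemxAr -scalemxAr -!scalemxAl !mxtraceZ.
    by rewrite mulrCA mulrA.
  have trZ c a b T : coupling t b a = T ->
      \tr (c *: (P a t *m ('i%C *: x *m u t) *m P b t) *m x) =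
      c * ('i%C * expi (th b t) * T).
    by move=> <-; rewrite -scalemxAl mxtraceZ trE.
  transitivity ((expi (th k t) - expi (th j t))^-1 *
      ('i%C * expi (th k t) * coupling t k j) -
      (expi (th j t) - expi (th k t))^-1 *
      ('i%C * expi (th j t) * coupling t k j)).
    rewrite mulmxBl linearB /=; congr (_ - _); first exact: trZ.
    exact: trZ (couplingC t k j).
  move: (coupling t k j) lamkj => T.
  move: (expi (th k t)) (expi (th j t)) => a b ab.
  (* After this sign change the two terms add up to i (a + b) / (a - b) times [T]. *)
  have -> : b - a = - (a - b) by rewrite opprB.
  rewrite invrN; move: ab; rewrite -unitfE => ab.
  by ring.
have slope : complex.Re (\tr (((h - t)^-1%:C%C *: (P k h - P k t)) *m x)) @[h --> F] -->
    complex.Re L.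
  have trL : \tr (((h - t)^-1%:C%C *: (P k h - P k t)) *m x) @[h --> F] --> (L : C).
    apply: cvg_mxtrace; apply: cvg_mulmx; last exact: cvg_cst.
    exact: (proj_slope Dt).
  by have [] := cvg_Re_Im trL.
rewrite LE /= in slope.
apply: cvg_trans slope; apply: near_eq_cvg.
(* The formula for the inner derivative holds on the interval only, which is where the filter
   lives. *)
have near_dom : \forall h \near F, 0 <= h <= t0 by exact: near_domain.
apply: filterS near_dom => h Dh.
rewrite !derive1_th// -scalemxAl mxtraceZ mulmxBl linearB /=.
rewrite -(tr_projx_real Dh k) -(tr_projx_real Dt k).
move: (complex.Re (\tr (P k h *m x))) (complex.Re (\tr (P k t *m x))) => p q.
by simpc.
Qed.

Lemma zero_curvature_diag s (Ds : 0 <= s <= t0) :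
  (forall m : nat, (1 <= m <= n.-1)%N -> \sum_(k < n | (k < m)%N)
     derive1_within `[0, t0] (derive1_within `[0, t0] (th k)) s = 0) ->
  forall j k, j != k -> P j s *m x *m P k s = 0.
Proof.
move=> curv.
have flux_gt0 (k j : 'I_n) : (k < j)%N -> 0 < flux s k j.
  move=> kj; have /andP[a1 a2] := th_bound Ds k; have /andP[b1 b2] := th_bound Ds j.
  have jk := th_dec Ds kj; apply: divr_gt0.
    by rewrite mulr_gt0//; apply: sin_gt0_pi; apply/andP; split; lra.
  apply: ltr_wpDl; first exact: sqr_ge0.
  by rewrite exprn_even_gt0//= subr_eq0 gt_eqF// sin_th_dec.
have fluxN k j : flux s j k = - flux s k j.
  rewrite -mulNr -[th j s - th k s]opprB sinN mulrN; congr (_ / _).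
  by rewrite -sqrrN opprB -[in X in _ + X = _]sqrrN opprB.
have coup_ge0 k j : 0 <= complex.Re (coupling s k j).
  by have := coupling_ge0 Ds j k; rewrite lecE => /andP[].
have zero (k j : 'I_n) : (k < j)%N -> P j s *m x *m P k s = 0.
  move=> kj; apply: mxtrace_mul_tC_eq0; rewrite -couplingE//.
  (* The cut is placed at [m = j]: it separates [k] from [j], and [k < j] makes it admissible, since
     indices start at 0. *)
  have jn : (1 <= j <= n.-1)%N.
    rewrite (leq_ltn_trans _ kj)//= -ltnS prednK ?ltn_ord//.
    exact: leq_ltn_trans (ltn_ord j).
  have := curv j jn.
  under eq_bigr do rewrite derive2_th//.
  move=> /(antisymmetric_flux _ _)/(_ k j kj (leqnn _)) => /(_ _ _)/wrap[||/eqP].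
  - by move=> a b; rewrite fluxN couplingC mulNr.
  - by move=> a b ab; rewrite mulr_ge0// ltW// flux_gt0.
  rewrite mulf_eq0 gt_eqF ?flux_gt0//= => /eqP coup0.
  rewrite -[LHS]RRe_real ?coup0// ger0_real//.
  exact: coupling_ge0.
(* The other triangle follows by taking adjoints, [x] and the projections being Hermitian. *)
move=> j k; rewrite neq_ltn => /orP[jk|]; last exact: zero.
have /(congr1 (fun A : 'M[R[i]]_n => A^t*)) := zero j k jk.
by rewrite !tC_mulmx x_herm !(sr_herm (srP Ds)) mulmxA trmx0 map_mx0.
Qed.

End Perturbation.

(** * Operator norm and conclusion *)

Section OperatorNorm.
Context {R : realType} {n : nat}.
Implicit Types (A z : 'M[R[i]]_n) (w : 'cV[R[i]]_n).

Lemma l2norm_scale (c : R[i]) w : l2norm (c *: w) = Normc.normc c * l2norm w.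
Proof.
rewrite /l2norm; under eq_bigr do rewrite mxE Normc.normcM exprMn.
rewrite -mulr_sumr sqrtrM ?sqr_ge0// sqrtr_sqr ger0_norm//.
by case: c => a b; exact: sqrtr_ge0.
Qed.

Lemma l2norm_eq0 w : l2norm w = 0 -> w = 0.
Proof.
move=> w0; apply: mxtrace_mul_tC_eq0.
by rewrite mxtrace_mulC l2norm_sqr w0 expr0n /= -scalemx1 scale0r mxtrace0.
Qed.

Lemma normc_ge0 (c : R[i]) : 0 <= Normc.normc c.
Proof. by case: c => a b; exact: sqrtr_ge0. Qed.

Lemma normc_sum (I : Type) (r : seq I) (f : I -> R[i]) :
  Normc.normc (\sum_(i <- r) f i) <= \sum_(i <- r) Normc.normc (f i).
Proof.
elim/big_rec2: _ => [|i a b _ ab]; first by rewrite Normc.normc0.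
by apply: le_trans (le_normcD _ _) _; rewrite lerD2l.
Qed.

Lemma normc_le_l2norm w i : Normc.normc (w i 0) <= l2norm w.
Proof.
rewrite -[leLHS]ger0_norm ?normc_ge0// -sqrtr_sqr; apply: ler_wsqrtr.
by rewrite (bigD1 i)//= lerDl; apply: sumr_ge0 => j _; exact: sqr_ge0.
Qed.

(** Needed for [sup] to be an upper bound. Entries of a vector in the unit ball have modulus at most
    1, so absolute row sums bound the image. *)
Lemma l2norm_mulmx_bound A : has_ubound
  [set l2norm (A *m v) | v in [set v : 'cV[R[i]]_n | l2norm v <= 1]].
Proof.
exists (Num.sqrt (\sum_i (\sum_j Normc.normc (A i j)) ^+ 2)) => _ [v /= v1 <-].
apply: ler_wsqrtr; apply: ler_sum => i _.
rewrite ler_pXn2r ?nnegrE ?normc_ge0//; last first.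
  by apply: sumr_ge0 => j _; exact: normc_ge0.
rewrite mxE (le_trans (normc_sum _ _))//; apply: ler_sum => j _.
rewrite Normc.normcM ler_piMr ?normc_ge0//.
exact: le_trans (normc_le_l2norm _ _) v1.
Qed.

Lemma eigenvalue_le_opnorm A w (c : R[i]) :
  w != 0 -> A *m w = c *: w -> Normc.normc c <= opnorm A.
Proof.
move=> w0 Aw; have lw : l2norm w != 0 by apply: contra_neq w0; exact: l2norm_eq0.
have lw_gt0 : 0 < l2norm w by rewrite lt_neqAle eq_sym lw sqrtr_ge0.
pose w1 := ((l2norm w)^-1)%:C%C *: w.
have lw1 : l2norm w1 = 1.
  rewrite l2norm_scale /= expr0n addr0 sqrtr_sqr gtr0_norm ?invr_gt0//.
  by rewrite mulVf.
have -> : Normc.normc c = l2norm (A *m w1).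
  by rewrite -scalemxAr Aw scalerA mulrC -scalerA l2norm_scale lw1 mulr1.
apply: ub_le_sup; first exact: l2norm_mulmx_bound.
by exists w1 => //=; rewrite lw1.
Qed.

Lemma opnorm0 : opnorm (0 : 'M[R[i]]_n) <= 0.
Proof.
have l0 : l2norm (0 : 'cV[R[i]]_n) = 0.
  by rewrite -(scale0r 0) l2norm_scale Normc.normc0 mul0r.
apply: ge_sup => [|_ [v _ <-]]; last by rewrite mul0mx l0.
by exists (l2norm ((0 : 'M[R[i]]_n) *m (0 : 'cV[R[i]]_n))); exists 0 => //=; rewrite l0.
Qed.

Lemma logmx_eigenvalue_bound A (a : R) :
  eigenvalue (- 'i%C *: logmx A) a%:C%C -> `|a| < pi.
Proof.
rewrite /logmx scalerA mulNr -expr2 sqr_i opprK scale1r.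
set z := xget _ _.
(* If there is no such logarithm, [z] is the default value 0, and the bound still
   holds. *)
have [z_herm z_lt] : z \is hermsymmx /\ opnorm z < pi.
  rewrite /z; case: xgetP => [_ _ [? _ ?] //|_].
  split; last by apply: le_lt_trans opnorm0 _; exact: pi_gt0.
  by apply/is_hermitianmxP; rewrite trmx0 map_mx0 scaler0.
move=> /eigenvalueP[r rz r0]; apply: le_lt_trans z_lt.
have -> : `|a| = Normc.normc a%:C%C by rewrite /= expr0n addr0 sqrtr_sqr.
(* [eigenvalue] provides a row vector; its adjoint is a column eigenvector, as [z] is Hermitian and
   [a] real. *)
apply: (@eigenvalue_le_opnorm _ (r^t*)).
  by apply: contra r0 => /eqP r0; rewrite -[r]trmxCK r0 trmx0 map_mx0.
rewrite -{1}(hermsymmx_tC z_herm) -tC_mulmx rz linearZ /= map_mxZ.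
congr (_ *: _); exact: conjc_real.
Qed.

End OperatorNorm.

Lemma principal_angle_bound {R : realType} (a : R) :
  `|a| < pi -> Normc.normc (expi a - 1) < Num.sqrt 2 ->
  - (pi / 2) < a < pi / 2.
Proof.
move=> api a2; have cos_gt0 : 0 < cos a.
  (* The squared distance from [expi a] to 1 is 2 - 2 cos a, so a value below 2 means a positive
     cosine. *)
  move: a2; rewrite /expi /= subr0 ltr_sqrt// => lt2.
  have := cos2Dsin2 a; nra.
move: api; rewrite ltr_norml => /andP[api1 api2].
apply/andP; split; rewrite ltNge; apply/negP => ha.
  have : 0 <= sin (- (a + pi / 2)) by apply: sin_ge0_pi; apply/andP; split; lra.
  by rewrite sinN sinDpihalf; lra.
have : 0 <= sin (a - pi / 2) by apply: sin_ge0_pi; apply/andP; split; lra.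
by rewrite sinBpihalf; lra.
Qed.

Lemma span_eigenvectors_stable {K : fieldType} (n : nat) (A : 'M[K]_n)
    (X : seq 'cV[K]_n) :
  (forall w, w \in X -> exists a, A *m w = a *: w) ->
  forall w, w \in <<X>>%VS -> A *m w \in <<X>>%VS.
Proof.
move=> AX w wX; rewrite (@coord_span _ _ _ (in_tuple X) _ wX) mulmx_sumr.
apply: rpred_sum => i _; rewrite -scalemxAr; apply: rpredZ.
have Xi : (in_tuple X)`_i \in X by apply: mem_nth.
by have [a ->] := AX _ Xi; apply/rpredZ/memv_span.
Qed.

(** Gathers the properties through which the exponential enters the main argument, with an abstract
    [E] in its place. *)
Lemma expmx_herm_group {R : realType} {n : nat} (x : 'M[R[i]]_n) :
  x \is hermsymmx -> exists E : R -> 'M[R[i]]_n,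
  [/\ forall t, expmx (('i%C * t%:C%C) *: x) = E t,
      forall t, E t \is unitarymx, E 0 = 1%:M,
      forall t, (h - t)^-1%:C%C *: (E h - E t) @[h --> t^'] -->
        (('i%C *: x) *m E t : 'M[R[i] : numFieldType]_n) &
      forall A t, A *m x = x *m A -> A *m E t = E t *m A].
Proof.
move=> hx; exists (fun t => expmx (('i%C * t%:C%C) *: x)); split=> //.
- exact: expmx_herm_unitary.
- exact: expmx_herm0.
- exact: expmx_herm_slope.
- exact: expmx_herm_comm.
Qed.

Theorem proposition3p6 (R : realType) (n : nat) (x y : 'M[R[i]]_n)
  (hx : x \is hermsymmx) (hy : y \is hermsymmx)
  (t0 : R) (ht0 : 0 < t0)
  (u : R -> 'M[R[i]]_n)
  (hu : forall t : R, u t = expmx (('i%C * t%:C%C) *: x) *m expmx ('i%C *: y))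
  (hnorm : forall t : R, 0 <= t <= t0 -> opnorm (u t - 1%:M) < Num.sqrt 2)
  (theta : 'I_n -> R -> R)
  (hdistinct : forall t : R, 0 <= t <= t0 ->
     injective (fun k => expi (theta k t)) /\
     forall k, eigenvalue (u t) (expi (theta k t)))
  (htheta : forall t : R, 0 <= t <= t0 ->
     (forall j k : 'I_n, (j < k)%N -> theta k t < theta j t) /\
     forall k, eigenvalue (- 'i%C *: logmx (u t)) (theta k t)%:C%C)
  (v : 'I_n -> R -> 'cV[R[i]]_n)
  (hv : forall t : R, 0 <= t <= t0 -> forall k,
     l2norm (v k t) = 1 /\ u t *m v k t = expi (theta k t) *: v k t)
  (s : R) (hs : 0 <= s <= t0)
  (hsum : forall m : nat, (1 <= m <= n.-1)%N ->
     \sum_(k < n | (k < m)%N)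
        derive1_within `[0, t0] (derive1_within `[0, t0] (theta k)) s = 0) :
  (forall m : nat, (1 <= m <= n.-1)%N ->
     let V := <<[seq v k s | k : 'I_n <- enum 'I_n & (k < m)%N]>>%VS in
     forall w, w \in V -> x *m w \in V /\ y *m w \in V) /\
  x *m y - y *m x = 0.

Proof.
have [E [EE E_unitary E0 E_slope E_comm]] := expmx_herm_group hx.
have [G [GE G_unitary _ _ G_comm]] := expmx_herm_group hy.
have {}hu t : u t = E t *m G 1 by rewrite hu EE -GE mulr1.
(* From here on exp(iy) is just a unitary [Y] commuting with [y]. *)
move: (G 1) (G_unitary 1) (G_comm y 1 erefl) hu => Y Y_unitary yY hu.
have u_unitary t : u t \is unitarymx by rewrite hu; exact: mul_unitarymx.
pose P k t := v k t *m (v k t)^t*.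
have sr t : 0 <= t <= t0 -> spectral_resolution (u t) (theta^~ t) (P^~ t).
  move=> Dt.
  exact: eigenvector_resolution (u_unitary t) (hdistinct t Dt).1 (hv t Dt).
have th_bound t : 0 <= t <= t0 -> forall k, - (pi / 2) < theta k t < pi / 2.
  move=> Dt k; apply: principal_angle_bound.
    exact: logmx_eigenvalue_bound ((htheta t Dt).2 k).
  apply: le_lt_trans (hnorm t Dt); have [vk1 uvk] := hv t Dt k.
  apply: (@eigenvalue_le_opnorm _ _ _ (v k t)).
    apply: contra_eq_neq vk1 => ->.
    by rewrite -(scale0r 0) l2norm_scale Normc.normc0 mul0r eq_sym oner_eq0.
  by rewrite mulmxBl mul1mx uvk scalerBl scale1r.
have u_slope t : (h - t)^-1%:C%C *: (u h - u t) @[h --> t^'] -->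
    (('i%C *: x) *m u t : 'M[R[i] : numFieldType]_n).
  have -> : (fun h => (h - t)^-1%:C%C *: (u h - u t)) =
      (fun h => ((h - t)^-1%:C%C *: (E h - E t)) *m Y).
    by apply/funext => h; rewrite !hu -mulmxBl scalemxAl.
  rewrite hu mulmxA; apply: cvg_mulmx; last exact: cvg_cst.
  exact: E_slope.
have D0 : 0 <= (0 : R) <= t0 by rewrite lexx ltW.
have inj t Dt := (hdistinct t Dt).1.
have x_diag := zero_curvature_diag (hermsymmx_tC hx) ht0 sr inj th_bound
  (fun t Dt => (htheta t Dt).1) u_slope hs hsum.
have xu : x *m u s = u s *m x.
  exact: resolution_diag_comm (sr s hs) _ _ x_diag (resolution_diag_u (sr s hs)).
have xE := E_comm x s erefl.
(* [x] commutes with [u s = E s *m Y] and with the invertible factor [E s], which can be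
   cancelled. *)
have xY : x *m Y = Y *m x.
  move: xu; rewrite hu mulmxA xE -!mulmxA.
  by move=> /(congr1 (mulmx (invmx (E s)))); rewrite !mulKmx// unitarymx_unit.
have u0 : u 0 = Y by rewrite hu E0 mul1mx.
(* The spectrum of [u 0 = Y] is simple, which makes up for the missing bound on the
   norm of [y]. *)
have diag0 A : A *m Y = Y *m A -> forall j k, j != k -> P j 0 *m A *m P k 0 = 0.
  by rewrite -u0 => Au; have := resolution_comm_diag (sr 0 D0) (inj 0 D0) Au.
have xy : x *m y = y *m x.
  exact: resolution_diag_comm (sr 0 D0) _ _ (diag0 x xY) (diag0 y yY).
(* Now that [y] commutes with [x], it commutes with both factors of [u s], whose simple spectrum
   makes [y] diagonal at time [s] too. *)
have yu : y *m u s = u s *m y.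
  by rewrite hu mulmxA (E_comm y s (esym xy)) -!mulmxA yY.
have y_diag := resolution_comm_diag (sr s hs) (inj s hs) yu.
have eigen A : (forall j k, j != k -> P j s *m A *m P k s = 0) ->
    forall k, exists a, A *m v k s = a *: v k s.
  move=> A_diag k; exists (\tr (P k s *m A)).
  (* The identity for [A *m P k s] is applied to [v k s], which [P k s] fixes because it is a unit
     vector. *)
  have [/(congr1 (fun B => B *m v k s)) + _] := resolution_diag (sr s hs) A_diag k.
  rewrite /P -scalemxAl mulmxA -!(mulmxA _ _ (v k s)) l2norm_sqr (hv s hs k).1.
  by rewrite expr1n rmorph1 !mulmx1.
split; last by rewrite xy subrr.
move=> m _ V w wV; split; apply: span_eigenvectors_stable => // _ /mapP[k _ ->];
  exact: eigen.
Qed.
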